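(* Let $m\ge 1$ and consider the labeled chip-firing process on $\mathbb{Z}$ starting with $2m$ chips labeled $-m,\dots,-1,1,\dots,m$ at site $0$. When the process terminates (i.e. a configuration is reached in which no firing move is possible), each chip $k$ is at position $k$, regardless of the choices of firing moves made.
   Context: Labeled chip-firing on the infinite path graph $\mathbb{Z}$ (each integer $i$ adjacent to $i-1$ and $i+1$): a firing move consists of choosing two chips with labels $a<b$ located at a common site $i$, and moving chip $a$ to site $i-1$ and chip $b$ to site $i+1$. The process terminates when all chips occupy distinct sites. *)

(* Defs.v *)
From Stdlib Require Import ZArith Relations.
Open Scope Z_scope.

Definition is_label (m k : Z) : Prop := -m <= k <= m /\ k <> 0.

(* A configuration assigns to each label its site on Z
   (values on non-labels are irrelevant and never changed by moves). *)
Definition config := Z -> Z.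

Definition init_config : config := fun _ => 0.

Definition fire_step (m : Z) (c c' : config) : Prop :=
  exists a b i : Z,
    is_label m a /\ is_label m b /\ a < b /\ c a = i /\ c b = i /\
    c' = (fun x => if Z.eqb x a then i - 1
                   else if Z.eqb x b then i + 1 else c x).

Definition reachable (m : Z) : config -> config -> Prop :=
  clos_refl_trans config (fire_step m).

Definition terminal (m : Z) (c : config) : Prop :=
  forall a b, is_label m a -> is_label m b -> a <> b -> c a <> c b.

(* Main.v *)
(** Let [v i] be the number of firings of site [i] still to come; up to a
    discrete Laplacian of [v], the number of chips at [i] is its final value.
    Legality of the moves alone forces [v] to interlace on neighbouring sites as
    soon as [v i <= m - |i|] ([interlaced]), so that such late firings happen
    with exactly two chips at [i].  A chip [a] moves left only together with some
    [b > a] at the same site; hence the chip [k > 0] never lies to the left of a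
    front, the first [j >= k - m] with [v j + max 0 j >= k], which advances when
    its own site makes a late firing, carrying the chip along; it is enough to
    exhibit some such [j <= c k] ([front_witness]).  At the end [v = 0]
    and the front of [k] is at [k].  Negative labels follow by reflection. *)

Require Import Defs.
From Stdlib Require Import ZArith Relations.
From Stdlib Require Import List Lia FinFun.
Open Scope Z_scope.

Local Arguments Z.mul : simpl never.

(** * Labels as a list, and the number of chips at a site *)

Definition pos_labels (m : Z) : list Z :=
  map (fun n => Z.of_nat (S n)) (seq 0 (Z.to_nat m)).

Definition labels (m : Z) : list Z := pos_labels m ++ map Z.opp (pos_labels m).

Lemma in_pos_labels m k : In k (pos_labels m) <-> 1 <= k <= m.
Proof.
  unfold pos_labels; rewrite in_map_iff; split.
  - intros [n [<- Hn]]; apply in_seq in Hn; lia.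
  - intros Hk; exists (Z.to_nat (k - 1)); rewrite in_seq; lia.
Qed.

Lemma in_labels m k : In k (labels m) <-> is_label m k.
Proof.
  unfold labels, is_label; rewrite in_app_iff, in_map_iff, in_pos_labels; split.
  - intros [H | [x [<- Hx]]]; [lia |]; apply in_pos_labels in Hx; lia.
  - intros H; destruct (Z_lt_le_dec 0 k); [left; lia |].
    right; exists (- k); rewrite in_pos_labels; lia.
Qed.

Lemma NoDup_labels m : NoDup (labels m).
Proof.
  assert (Hpos : NoDup (pos_labels m)).
  { apply Injective_map_NoDup; [intros x y; lia | apply seq_NoDup]. }
  apply NoDup_app; [exact Hpos | |].
  - apply Injective_map_NoDup; [intros x y; lia | exact Hpos].
  - intros k Hk Hk'; apply in_map_iff in Hk' as [x [<- Hx]].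
    apply in_pos_labels in Hk, Hx; lia.
Qed.

Lemma length_labels m : 0 <= m -> Z.of_nat (length (labels m)) = 2 * m.
Proof.
  intros Hm; unfold labels, pos_labels.
  rewrite length_app, !length_map, length_seq; lia.
Qed.

Definition chips_at (l : list Z) (c : config) (i : Z) : list Z :=
  filter (fun x => c x =? i) l.

Definition count (l : list Z) (c : config) (i : Z) : Z :=
  Z.of_nat (length (chips_at l c i)).

Lemma in_chips_at l c i x : In x (chips_at l c i) <-> In x l /\ c x = i.
Proof. unfold chips_at; rewrite filter_In, Z.eqb_eq; reflexivity. Qed.

Lemma count_lower l c i s :
  NoDup s -> (forall x, In x s -> In x l /\ c x = i) ->
  Z.of_nat (length s) <= count l c i.
Proof.
  intros Hs Hin; apply Nat2Z.inj_le, NoDup_incl_length; [exact Hs |].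
  intros x Hx; apply in_chips_at; auto.
Qed.

Lemma count_ge2 l c i :
  NoDup l -> 2 <= count l c i ->
  exists a b, In a l /\ In b l /\ a <> b /\ c a = i /\ c b = i.
Proof.
  intros Hl; unfold count.
  pose proof (NoDup_filter (fun x => c x =? i) Hl) as Hnd.
  pose proof (in_chips_at l c i) as Hin.
  fold (chips_at l c i) in Hnd.
  destruct (chips_at l c i) as [| a [| b s]]; simpl length; try lia.
  intros _; exists a, b.
  destruct (proj1 (Hin a)) as [? ?]; [simpl; auto |].
  destruct (proj1 (Hin b)) as [? ?]; [simpl; auto |].
  inversion Hnd as [| ? ? Hna _]; subst.
  repeat split; auto; intros ->; apply Hna; simpl; auto.
Qed.

Lemma count_ext l c c' i :
  (forall x, In x l -> c x = c' x) -> count l c i = count l c' i.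
Proof.
  intros H; unfold count, chips_at; do 2 f_equal.
  apply filter_ext_in; intros x Hx; rewrite H; auto.
Qed.

Lemma count_cons x l c i :
  count (x :: l) c i = (if c x =? i then 1 else 0) + count l c i.
Proof. unfold count, chips_at; simpl; destruct (c x =? i); simpl length; lia. Qed.

Lemma count_update l c c' x i :
  NoDup l -> In x l -> (forall y, y <> x -> c' y = c y) ->
  count l c' i =
  count l c i - (if c x =? i then 1 else 0) + (if c' x =? i then 1 else 0).
Proof.
  intros Hl Hx Hc; induction Hl as [| z l Hz Hl IH]; [destruct Hx |].
  rewrite !count_cons; destruct Hx as [-> | Hx].
  - rewrite (count_ext l c' c); [lia |].
    intros y Hy; apply Hc; intros ->; contradiction.
  - rewrite (Hc z) by (intros ->; contradiction).
    rewrite IH by assumption; lia.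
Qed.

(** * Moves, their effect on the counts, and reflection *)

(** Pointwise form of a move: unlike the equality of functions in [fire_step], it passes to [mirror]
    without functional extensionality. *)
Record fires (c c' : config) (a b i : Z) : Prop := {
  fires_lt : a < b;
  fires_src_l : c a = i;
  fires_src_r : c b = i;
  fires_dst_l : c' a = i - 1;
  fires_dst_r : c' b = i + 1;
  fires_other : forall x, x <> a -> x <> b -> c' x = c x }.

Lemma fire_stepE m c c' :
  fire_step m c c' ->
  exists a b i, is_label m a /\ is_label m b /\ fires c c' a b i.
Proof.
  intros (a & b & i & Ha & Hb & Hab & Hca & Hcb & ->).
  exists a, b, i; split; [| split]; auto; constructor; auto.
  - now rewrite Z.eqb_refl.
  - rewrite Z.eqb_refl; destruct (Z.eqb_spec b a); [lia | reflexivity].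
  - intros x Hxa Hxb; destruct (Z.eqb_spec x a), (Z.eqb_spec x b); tauto.
Qed.

Lemma count_fires l c c' a b i j :
  NoDup l -> In a l -> In b l -> fires c c' a b i ->
  count l c' j =
  count l c j + (if j =? i - 1 then 1 else 0) + (if j =? i + 1 then 1 else 0)
  - (if j =? i then 2 else 0).
Proof.
  intros Hl Ha Hb [Hab Hca Hcb Hca' Hcb' Ho].
  (* In [d] only [b] has moved, so the move splits into two one-chip updates. *)
  set (d := fun x => if x =? b then i + 1 else c x).
  assert (Hd : forall x, x <> b -> d x = c x).
  { intros x Hx; unfold d; destruct (Z.eqb_spec x b); tauto. }
  assert (Hdb : d b = i + 1) by (unfold d; now rewrite Z.eqb_refl).
  assert (Hd' : forall x, x <> a -> c' x = d x).
  { intros x Hx; destruct (Z.eq_dec x b) as [-> | Hxb]; [congruence |].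
    rewrite Hd by assumption; auto. }
  rewrite (count_update l d c' a j Hl Ha Hd'), (count_update l c d b j Hl Hb Hd).
  rewrite (Hd a), Hca, Hcb, Hdb, Hca' by lia.
  rewrite !(Z.eqb_sym j).
  destruct (Z.eqb_spec i j), (Z.eqb_spec (i + 1) j), (Z.eqb_spec (i - 1) j); lia.
Qed.

Definition mirror_profile (v : Z -> Z) : Z -> Z := fun i => v (- i).
Definition mirror (c : config) : config := fun x => - c (- x).

(** Negation reverses the order of labels, so the right-moving [b] becomes the left-moving [- b]. *)
Lemma fires_mirror c c' a b i :
  fires c c' a b i -> fires (mirror c) (mirror c') (- b) (- a) (- i).
Proof.
  intros [Hab Hca Hcb Hca' Hcb' Ho]; unfold mirror.
  constructor; rewrite ?Z.opp_involutive; try lia.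
  intros x Hxa Hxb; rewrite Ho; lia.
Qed.

(** * Profiles of remaining firings *)

(** When [v i] and [v (i + 1)] are at most the cap [m - i], this reads
    [v (i + 1) <= v i <= v (i + 1) + 1]: the two sites fire alternately. The left half-line is
    covered by applying it to [mirror_profile v]. *)
Definition interlaced (m : Z) (v : Z -> Z) : Prop :=
  forall i, 0 <= i ->
  Z.min (v (i + 1)) (m - i) <= v i /\ Z.min (v i) (m - i) <= v (i + 1) + 1.

Definition final_count (m i : Z) : Z :=
  if i =? 0 then 0 else if Z.abs i <=? m then 1 else 0.

Lemma final_count_cases m i :
  1 <= m ->
  i = 0 /\ final_count m i = 0 \/
  1 <= Z.abs i <= m /\ final_count m i = 1 \/
  m < Z.abs i /\ final_count m i = 0.
Proof.
  intros Hm; unfold final_count.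
  destruct (Z.eqb_spec i 0); [lia |]; destruct (Z.leb_spec (Z.abs i) m); lia.
Qed.

Record profile (m : Z) (v : Z -> Z) (c : config) : Prop := {
  profile_ge0 : forall i, 0 <= v i;
  profile_out : forall i, m <= Z.abs i -> v i = 0;
  profile_right : interlaced m v;
  profile_left : interlaced m (mirror_profile v);
  profile_count : forall i, count (labels m) c i =
    final_count m i + 2 * v i - v (i - 1) - v (i + 1) }.

Definition fire_profile (v : Z -> Z) (i : Z) : Z -> Z :=
  fun j => if j =? i then v j - 1 else v j.

Lemma fire_profile_same v i : fire_profile v i i = v i - 1.
Proof. unfold fire_profile; now rewrite Z.eqb_refl. Qed.

Lemma fire_profile_other v i j : j <> i -> fire_profile v i j = v j.
Proof. intros H; unfold fire_profile; destruct (Z.eqb_spec j i); tauto. Qed.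

(** Only the inequalities with [v i] on the larger side can break. If [v i] is above the cap, they
    survive the decrease; otherwise the old inequality with the neighbour on the other side of [i],
    combined with [2 * v i - v (i - 1) - v (i + 1)] being large enough, bounds the neighbour in
    question. For [i = 0] that other neighbour is [-1], whence the mirrored hypothesis. *)
Lemma interlaced_fire m v v' i :
  interlaced m v -> interlaced m (mirror_profile v) ->
  v' i = v i - 1 -> (forall j, j <> i -> v' j = v j) ->
  (if i =? 0 then 2 else 1) <= 2 * v i - v (i - 1) - v (i + 1) ->
  interlaced m v'.
Proof.
  intros Hr Hl Hi Ho Hfire j Hj.
  destruct (Hr j Hj) as [H1 H2].
  destruct (Z.eq_dec j i) as [-> | Hji].
  - rewrite Hi, (Ho (i + 1)) by lia; split; [| lia].
    destruct (Z.eqb_spec i 0) as [-> | Hi0].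
    + destruct (Hl 0 Hj) as [_ H3]; unfold mirror_profile in H3; simpl in *; lia.
    + destruct (Hr (i - 1)) as [H3 _]; [lia |].
      replace (i - 1 + 1) with i in H3 by lia; lia.
  - destruct (Z.eq_dec (j + 1) i) as [Hji' | Hji'].
    + assert (j = i - 1) by lia; subst j.
      replace (i - 1 + 1) with i in * by lia.
      rewrite (Ho (i - 1)), Hi by assumption; split; [lia |].
      destruct (Z.eqb_spec i 0); [lia |].
      destruct (Hr i) as [_ H3]; [lia |]; lia.
    + rewrite !Ho by assumption; auto.
Qed.

Lemma interlaced_ext m v w :
  (forall i, v i = w i) -> interlaced m v -> interlaced m w.
Proof. intros H Hv i Hi; rewrite <- !H; auto. Qed.

Lemma profile_fire_count m v c c' a b i :
  profile m v c -> is_label m a -> is_label m b -> fires c c' a b i ->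
  2 <= final_count m i + 2 * v i - v (i - 1) - v (i + 1).
Proof.
  intros Hp Ha Hb [Hab Hca Hcb _ _ _].
  rewrite <- (profile_count _ _ _ Hp).
  apply (count_lower _ _ _ (a :: b :: nil)).
  - repeat constructor; simpl; intuition lia.
  - intros x [<- | [<- | []]]; rewrite in_labels; auto.
Qed.

Lemma profile_fire m v c c' a b i :
  1 <= m ->
  profile m v c -> is_label m a -> is_label m b -> fires c c' a b i ->
  profile m (fire_profile v i) c'.
Proof.
  intros Hm Hp Ha Hb Hf.
  pose proof (profile_fire_count _ _ _ _ _ _ _ Hp Ha Hb Hf) as H2.
  pose proof (final_count_cases m i Hm) as Hfc.
  destruct Hp as [Hge Hout Hr Hl Hcount].
  (* Two chips exceed [final_count], and the neighbouring values are nonnegative. In particular no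
     site with [m <= |i|] can fire. *)
  assert (Hpos : 1 <= v i).
  { pose proof (Hge i); pose proof (Hge (i - 1)); pose proof (Hge (i + 1)); lia. }
  assert (Hfire : (if i =? 0 then 2 else 1) <= 2 * v i - v (i - 1) - v (i + 1)).
  { destruct (Z.eqb_spec i 0); lia. }
  constructor.
  - intros j; unfold fire_profile; pose proof (Hge j).
    destruct (Z.eqb_spec j i) as [-> |]; lia.
  - intros j Hj; pose proof (Hout j Hj); unfold fire_profile.
    destruct (Z.eqb_spec j i) as [-> |]; lia.
  - apply (interlaced_fire m v _ i); auto.
    + apply fire_profile_same.
    + apply fire_profile_other.
  - apply (interlaced_fire m (mirror_profile v) _ (- i)); auto.
    + apply (interlaced_ext m v); auto.
      intros j; unfold mirror_profile; f_equal; lia.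
    + unfold mirror_profile; rewrite Z.opp_involutive; apply fire_profile_same.
    + intros j Hj; unfold mirror_profile; apply fire_profile_other; lia.
    + unfold mirror_profile.
      replace (- - i) with i by lia.
      replace (- (- i - 1)) with (i + 1) by lia.
      replace (- (- i + 1)) with (i - 1) by lia.
      destruct (Z.eqb_spec (- i) 0), (Z.eqb_spec i 0); lia.
  - intros j.
    rewrite (count_fires (labels m) c c' a b i j);
      [| apply NoDup_labels | now apply in_labels | now apply in_labels | exact Hf].
    rewrite Hcount; unfold fire_profile.
    destruct (Z.eqb_spec j i), (Z.eqb_spec (j - 1) i), (Z.eqb_spec (j + 1) i),
      (Z.eqb_spec j (i - 1)), (Z.eqb_spec j (i + 1)); lia.
Qed.

(** Off the origin, interlacing bounds the inner neighbour below by [v i] and the outer one by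
    [v i - 1], so the count is at most [1 + 1]. At the origin both neighbours are at least [v 0 - 1]
    and [final_count] is 0. *)
Lemma late_firing_count m v c i :
  1 <= m -> profile m v c -> v i <= m - Z.abs i -> count (labels m) c i <= 2.
Proof.
  intros Hm [Hge Hout Hr Hl Hcount] Hlate; rewrite Hcount.
  pose proof (final_count_cases m i Hm) as Hfc.
  unfold interlaced, mirror_profile in Hl.
  destruct (Z.lt_trichotomy i 0) as [Hi | [-> | Hi]].
  - destruct (Hl (- i)) as [_ H1]; [lia |].
    destruct (Hl (- i - 1)) as [H2 _]; [lia |].
    replace (- (- i)) with i in * by lia.
    replace (- (- i + 1)) with (i - 1) in * by lia.
    replace (- (- i - 1 + 1)) with i in * by lia.
    replace (- (- i - 1)) with (i + 1) in * by lia.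
    lia.
  - destruct (Hl 0) as [_ H1]; [lia |]; destruct (Hr 0) as [_ H2]; [lia |].
    simpl in *; lia.
  - destruct (Hr i) as [_ H1]; [lia |]; destruct (Hr (i - 1)) as [H2 _]; [lia |].
    replace (i - 1 + 1) with i in H2 by lia; lia.
Qed.

(** * Fronts and their motion *)

(** The bound [k - m <= j] gives [k <= m - |j|] for [j <= 0], so the caps in [interlaced] do not
    interfere when [v j] is compared with [k]. *)
Definition front_witness (m : Z) (v : Z -> Z) (k j : Z) : Prop :=
  k - m <= j /\ k <= v j + Z.max 0 j.

Definition ahead_of_fronts (m : Z) (v : Z -> Z) (c : config) : Prop :=
  forall k, 1 <= k <= m -> exists j, j <= c k /\ front_witness m v k j.

(** Going from [j] to [j - 1] lowers the guaranteed level by at most one: for [0 < j] only the term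
    [Z.max 0 j] drops, for [j <= 0] only [v] does. *)
Lemma front_witness_pred m v k j :
  interlaced m v -> interlaced m (mirror_profile v) -> k <= m ->
  front_witness m v (k + 1) j -> front_witness m v k (j - 1).
Proof.
  intros Hr Hl Hk [H1 H2]; split; [lia |].
  destruct (Z_lt_le_dec 0 j) as [Hj | Hj].
  - destruct (Hr (j - 1)) as [H3 _]; [lia |].
    replace (j - 1 + 1) with j in H3 by lia; lia.
  - destruct (Hl (- j)) as [_ H3]; [lia |]; unfold mirror_profile in H3.
    replace (- (- j)) with j in H3 by lia.
    replace (- (- j + 1)) with (j - 1) in H3 by lia; lia.
Qed.

(** Witnesses for smaller labels trail by the difference of the labels; this leaves [a] room to step
    left when it fires with [b]. *)
Lemma front_witness_lt m v k l j :
  interlaced m v -> interlaced m (mirror_profile v) -> k < l <= m ->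
  front_witness m v l j -> front_witness m v k (j - (l - k)).
Proof.
  intros Hr Hl Hk.
  assert (H : forall n, 0 <= n -> forall k' j', k' + n <= m ->
    front_witness m v (k' + n) j' -> front_witness m v k' (j' - n)).
  { intros n Hn; pattern n; apply natlike_ind; [| | exact Hn].
    - intros k' j' _; now rewrite Z.add_0_r, Z.sub_0_r.
    - intros p Hp IH k' j' Hk' Hb.
      replace (j' - Z.succ p) with (j' - p - 1) by lia.
      apply front_witness_pred; [auto | auto | lia |]; apply IH; [lia |].
      now replace (k' + 1 + p) with (k' + Z.succ p) by lia. }
  intros Hb; apply H; [lia | lia |].
  now replace (k + (l - k)) with l by lia.
Qed.

(** At a tight witness [v j] is within the cap, so interlacing applies: for [j < 0] the value [v]
    does not fall at [j + 1], and for [0 <= j] it falls by at most the one that [Z.max 0 j]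
    gains. *)
Lemma front_witness_succ m v k j :
  interlaced m v -> interlaced m (mirror_profile v) -> k <= m ->
  front_witness m v k j -> v j + Z.max 0 j = k -> front_witness m v k (j + 1).
Proof.
  intros Hr Hl Hk [H1 _] H2; split; [lia |].
  destruct (Z_lt_le_dec j 0) as [Hj | Hj].
  - destruct (Hl (- j - 1)) as [H3 _]; [lia |]; unfold mirror_profile in H3.
    replace (- (- j - 1 + 1)) with j in H3 by lia.
    replace (- (- j - 1)) with (j + 1) in H3 by lia; lia.
  - destruct (Hr j Hj) as [_ H3]; lia.
Qed.

(** The new profile [v'] is given only pointwise, so that the lemma also serves the mirrored
    move. *)
Lemma ahead_of_fronts_fire m v v' c c' a b i :
  interlaced m v -> interlaced m (mirror_profile v) ->
  is_label m a -> is_label m b -> fires c c' a b i ->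
  v' i = v i - 1 -> (forall j, j <> i -> v' j = v j) ->
  (v i <= m - Z.abs i -> forall x, is_label m x -> c x = i -> x = a \/ x = b) ->
  ahead_of_fronts m v c -> ahead_of_fronts m v' c'.
Proof.
  intros Hr Hl Ha Hb [Hab Hca Hcb Hca' Hcb' Ho] Hvi Hvo Hlate Hfront k Hk.
  destruct (Z.eq_dec k a) as [-> | Hka].
  (* The left-moving chip inherits a witness from [b]; it lies strictly left of [i], where the
     profile is unchanged. *)
  - destruct (Hfront b) as [j [Hj Hbj]]; [destruct Hb; lia |].
    exists (j - (b - a)); split; [lia |].
    destruct (front_witness_lt m v a b j) as [H1 H2]; auto; [destruct Hb; lia |].
    split; [lia |]; rewrite Hvo; lia.
  - assert (Hmono : c k <= c' k).
    { destruct (Z.eq_dec k b) as [-> |]; [lia | rewrite Ho; lia]. }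
    destruct (Hfront k Hk) as [j [Hj [Hj1 Hj2]]].
    destruct (Z.eq_dec j i) as [-> | Hji].
    + destruct (Z.eq_dec (v i + Z.max 0 i) k) as [Heq | Hneq].
      (* The firing spoils the tight witness [i], but tightness makes it late: only [a] and [b] are
         at [i]. So chip [k] is [b], which moves to [i + 1], or was already to the right of [i]. *)
      * exists (i + 1); split.
        -- destruct (Z.eq_dec k b) as [-> | Hkb]; [lia |].
           rewrite Ho by assumption.
           enough (c k <> i) by lia; intros Hck.
           destruct (Hlate ltac:(lia) k); auto; split; lia.
        -- destruct (front_witness_succ m v k i) as [H1 H2]; auto; [lia | split; auto |].
           split; [lia |]; rewrite Hvo; lia.
      * exists i; split; [lia |]; split; lia.
    + exists j; split; [lia |]; split; [lia |]; rewrite Hvo; lia.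
Qed.

(** * The invariant and its preservation by moves *)

Definition invariant (m : Z) (v : Z -> Z) (c : config) : Prop :=
  profile m v c /\ ahead_of_fronts m v c /\
  ahead_of_fronts m (mirror_profile v) (mirror c).

Lemma is_label_opp m k : is_label m k -> is_label m (- k).
Proof. unfold is_label; lia. Qed.

Lemma invariant_step m v c c' :
  1 <= m -> invariant m v c -> fire_step m c c' ->
  exists v', invariant m v' c'.
Proof.
  intros Hm (Hp & Hright & Hleft) Hs.
  apply fire_stepE in Hs as (a & b & i & Ha & Hb & Hf).
  assert (Hlate : v i <= m - Z.abs i ->
    forall x, is_label m x -> c x = i -> x = a \/ x = b).
  { intros Hv x Hx Hcx.
    pose proof (late_firing_count m v c i Hm Hp Hv) as H2.
    destruct (Z.eq_dec x a) as [| Hxa]; [auto |].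
    destruct (Z.eq_dec x b) as [| Hxb]; [auto |].
    destruct Hf as [Hab Hca Hcb _ _ _].
    assert (H3 : Z.of_nat (length (x :: a :: b :: nil)) <= count (labels m) c i).
    { apply count_lower.
      - repeat constructor; simpl; intuition lia.
      - intros y [<- | [<- | [<- | []]]]; rewrite in_labels; auto. }
    simpl length in H3; lia. }
  pose proof (profile_right _ _ _ Hp) as Hr.
  pose proof (profile_left _ _ _ Hp) as Hl.
  exists (fire_profile v i); split; [| split].
  - now apply (profile_fire m v c c' a b i).
  - apply (ahead_of_fronts_fire m v _ c c' a b i); auto.
    + apply fire_profile_same.
    + apply fire_profile_other.
  - apply (ahead_of_fronts_fire m (mirror_profile v) _ (mirror c) (mirror c')
             (- b) (- a) (- i)); auto using is_label_opp, fires_mirror.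
    + apply (interlaced_ext m v); auto.
      intros j; unfold mirror_profile; f_equal; lia.
    + unfold mirror_profile; rewrite Z.opp_involutive; apply fire_profile_same.
    + intros j Hj; unfold mirror_profile; apply fire_profile_other; lia.
    + unfold mirror_profile, mirror; rewrite Z.opp_involutive, Z.abs_opp.
      intros Hv x Hx Hcx.
      destruct (Hlate Hv (- x)); auto using is_label_opp; lia.
Qed.

(** * The initial profile *)

(** Triangular numbers in [m - |i|]: their second difference 1 cancels [final_count] for
    [1 <= |i| <= m], and at the origin twice the first difference gives the pile of [2 * m]
    chips. *)
Definition init_profile (m : Z) : Z -> Z :=
  fun i => let x := Z.max 0 (m - Z.abs i) in x * (x + 1) / 2.

Lemma init_profileE m i :
  2 * init_profile m i =
  Z.max 0 (m - Z.abs i) * (Z.max 0 (m - Z.abs i) + 1).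
Proof.
  unfold init_profile; set (x := Z.max 0 (m - Z.abs i)).
  assert (H : (x * (x + 1)) mod 2 = 0).
  { rewrite Zmod_even, Z.even_mul, Z.even_add; now destruct (Z.even x). }
  pose proof (Z_div_mod_eq_full (x * (x + 1)) 2); lia.
Qed.

Lemma init_profile_opp m i : init_profile m (- i) = init_profile m i.
Proof. unfold init_profile; now rewrite Z.abs_opp. Qed.

Lemma init_interlaced m : 1 <= m -> interlaced m (init_profile m).
Proof.
  intros Hm i Hi.
  pose proof (init_profileE m i) as H1.
  pose proof (init_profileE m (i + 1)) as H2.
  rewrite !Z.abs_eq in * by lia.
  destruct (Z_lt_le_dec i m).
  - rewrite !Z.max_r in * by lia.
    remember (m - i) as x; replace (m - (i + 1)) with (x - 1) in * by lia.
    split; [nia |].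
    enough (x <= init_profile m (i + 1) + 1) by lia.
    (* This product is twice the slack in [x <= x * (x - 1) / 2 + 1]. *)
    assert (0 <= (x - 1) * (x - 2)) by nia; nia.
  - rewrite !Z.max_l in * by lia; lia.
Qed.

Lemma count_const l s i :
  count l (fun _ => s) i = if s =? i then Z.of_nat (length l) else 0.
Proof.
  induction l as [| x l IH].
  - now destruct (s =? i).
  - rewrite count_cons, IH; destruct (s =? i); simpl length; lia.
Qed.

Lemma init_profile_valid m : 1 <= m -> profile m (init_profile m) init_config.
Proof.
  intros Hm; constructor.
  - intros i; pose proof (init_profileE m i); nia.
  - intros i Hi; pose proof (init_profileE m i) as H.
    rewrite Z.max_l in H by lia; lia.
  - now apply init_interlaced.
  - apply (interlaced_ext m (init_profile m)); [| now apply init_interlaced].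
    intros i; symmetry; apply init_profile_opp.
  - intros i; unfold init_config; rewrite count_const, length_labels by lia.
    pose proof (final_count_cases m i Hm) as Hfc.
    pose proof (init_profileE m i) as H0.
    pose proof (init_profileE m (i - 1)) as H1.
    pose proof (init_profileE m (i + 1)) as H2.
    destruct (Z.eqb_spec 0 i) as [<- | Hi].
    + simpl Z.abs in *; rewrite !Z.max_r in * by lia.
      destruct Hfc as [[_ ->] | [|]]; try lia; nia.
    + destruct (Z_lt_le_dec m (Z.abs i)).
      { rewrite !Z.max_l in * by lia; lia. }
      destruct Hfc as [| [[_ ->] | ]]; try lia.
      destruct (Z.eq_dec (Z.abs i) m).
      (* At [|i| = m] the truncation takes effect: the inner neighbour has value 1, the outer one
         0. *)
      * rewrite (Z.max_l 0 (m - Z.abs i)) in * by lia.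
        assert (init_profile m (i - 1) + init_profile m (i + 1) = 1); [| lia].
        destruct (Z_lt_le_dec 0 i).
        -- replace (m - Z.abs (i - 1)) with 1 in * by lia.
           replace (m - Z.abs (i + 1)) with (-1) in * by lia; simpl in *; lia.
        -- replace (m - Z.abs (i - 1)) with (-1) in * by lia.
           replace (m - Z.abs (i + 1)) with 1 in * by lia; simpl in *; lia.
      * rewrite !Z.max_r in * by lia.
        destruct (Z_lt_le_dec 0 i);
          [rewrite !Z.abs_eq in * by lia | rewrite !Z.abs_neq in * by lia]; nia.
Qed.

Lemma init_ahead_of_fronts m :
  ahead_of_fronts m (init_profile m) init_config.
Proof.
  (* At the leftmost admissible site [k - m], the profile is the triangular number of [k], hence at
     least [k]. *)
  intros k Hk; exists (k - m); unfold init_config; split; [lia |]; split; [lia |].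
  pose proof (init_profileE m (k - m)) as H.
  replace (Z.max 0 (m - Z.abs (k - m))) with k in H by lia; nia.
Qed.

Lemma init_invariant m : 1 <= m -> invariant m (init_profile m) init_config.
Proof.
  intros Hm; split; [| split].
  - now apply init_profile_valid.
  - apply init_ahead_of_fronts.
  - intros k Hk.
    destruct (init_ahead_of_fronts m k Hk) as [j [Hj [H1 H2]]].
    exists j; split; [exact Hj |]; split; [exact H1 |].
    unfold mirror_profile; now rewrite init_profile_opp.
Qed.

Lemma reachable_invariant m c :
  1 <= m -> reachable m init_config c -> exists v, invariant m v c.
Proof.
  intros Hm Hc; apply clos_rt_rtn1 in Hc.
  induction Hc as [| c c' Hs _ [v IH]].
  - exists (init_profile m); now apply init_invariant.
  - now apply (invariant_step m v c).
Qed.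

(** * Vanishing of the profile of a terminal configuration *)

(** Convexity and a nonnegative first increment make [v] nondecreasing up to [m], so
    [v 0 <= v m = 0]. *)
Lemma convex_origin m v :
  1 <= m -> v m = 0 -> v 0 <= v 1 ->
  (forall i, 0 < i < m -> 2 * v i <= v (i - 1) + v (i + 1)) -> v 0 <= 0.
Proof.
  intros Hm Hvm H01 Hconv.
  assert (H : forall n, 0 <= n -> n < m -> v 0 <= v (n + 1) /\ v n <= v (n + 1)).
  { intros n Hn; pattern n; apply natlike_ind; [simpl; lia | | exact Hn].
    intros p Hp IH Hpm; destruct IH; [lia |].
    pose proof (Hconv (Z.succ p) ltac:(lia)) as H2.
    replace (Z.succ p - 1) with p in H2 by lia.
    replace (Z.succ p) with (p + 1) in * by lia; lia. }
  destruct (H (m - 1)) as [H' _]; try lia.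
  replace (m - 1 + 1) with m in H' by lia; lia.
Qed.

(** For [p < m] the cap [m - p] is positive, so [v p <= 0] forces [v (p + 1) <= 0]. *)
Lemma interlaced_zero m v :
  interlaced m v -> v 0 <= 0 -> forall i, 0 <= i <= m -> v i <= 0.
Proof.
  intros Hv H0 i [Hi Him]; revert Him; pattern i; apply natlike_ind; auto.
  intros p Hp IH Hpm; destruct (Hv p Hp) as [H1 _].
  unfold Z.succ; lia.
Qed.

Lemma terminal_profile m v c :
  1 <= m -> profile m v c -> terminal m c -> forall i, v i = 0.
Proof.
  intros Hm [Hge Hout Hr Hl Hcount] Hterm.
  assert (H1 : forall i, final_count m i + 2 * v i - v (i - 1) - v (i + 1) <= 1).
  { intros i; rewrite <- Hcount.
    destruct (Z_lt_le_dec 1 (count (labels m) c i)) as [H |]; [exfalso | lia].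
    destruct (count_ge2 (labels m) c i (NoDup_labels m) ltac:(lia))
      as (a & b & Ha & Hb & Hab & Hca & Hcb).
    apply in_labels in Ha, Hb; apply (Hterm a b); auto; congruence. }
  assert (H2 : forall i, 1 <= Z.abs i <= m -> 2 * v i <= v (i - 1) + v (i + 1)).
  { intros i Hi; pose proof (H1 i); pose proof (final_count_cases m i Hm); lia. }
  (* At the origin [2 * v 0 <= v (-1) + v 1 + 1], so by integrality [v 0] is at most one of its
     neighbours; convexity is used on that side. *)
  assert (H0 : v 0 <= 0).
  { destruct (Z_lt_le_dec (v 1) (v 0)) as [Hd |].
    - apply (convex_origin m (mirror_profile v)); unfold mirror_profile; auto.
      + apply Hout; lia.
      + pose proof (H1 0) as Hc; unfold final_count in Hc; simpl in *; lia.
      + intros i Hi; pose proof (H2 (- i) ltac:(lia)).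
        replace (- (i - 1)) with (- i + 1) by lia.
        replace (- (i + 1)) with (- i - 1) by lia; lia.
    - apply (convex_origin m v); auto.
      + apply Hout; lia.
      + intros i Hi; apply H2; lia. }
  intros i; destruct (Z_lt_le_dec m (Z.abs i)); [apply Hout; lia |].
  pose proof (Hge i); enough (v i <= 0) by lia.
  destruct (Z_lt_le_dec i 0).
  - pose proof (interlaced_zero m _ Hl H0 (- i) ltac:(lia)) as H'.
    unfold mirror_profile in H'; now rewrite Z.opp_involutive in H'.
  - apply (interlaced_zero m v Hr H0); lia.
Qed.

(** * Final positions *)

(** Downward induction from [k = m]: if [k < c k], the chip labelled [c k] already sits at [c k], a
    collision. *)
Lemma distinct_sites_sorted m (c : config) :
  (forall k, 1 <= k <= m -> k <= c k <= m) ->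
  (forall k l, 1 <= k <= m -> 1 <= l <= m -> k <> l -> c k <> c l) ->
  forall k, 1 <= k <= m -> c k = k.
Proof.
  intros Hc Hinj.
  assert (H : forall n, 0 <= n -> forall k, 1 <= k <= m -> m - k <= n -> c k = k).
  { intros n Hn; pattern n; apply natlike_ind; [| | exact Hn].
    - intros k Hk Hkn; pose proof (Hc k Hk); lia.
    - intros p Hp IH k Hk Hkp; pose proof (Hc k Hk) as Hck.
      destruct (Z.eq_dec (c k) k) as [| Hneq]; [assumption | exfalso].
      apply (Hinj k (c k)); try lia; symmetry; apply IH; lia. }
  intros k Hk; apply (H (m - k)); lia.
Qed.

(** With [v = 0] the counts are [final_count], which vanishes beyond [m], while the site of a chip
    has a positive count. *)
Lemma terminal_sites m v c k :
  1 <= m -> profile m v c -> (forall i, v i = 0) -> is_label m k ->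
  Z.abs (c k) <= m.
Proof.
  intros Hm Hp Hv Hk.
  pose proof (profile_count _ _ _ Hp (c k)) as H.
  rewrite !Hv in H.
  pose proof (count_lower (labels m) c (c k) (k :: nil)) as H1.
  simpl length in H1.
  enough (1 <= count (labels m) c (c k)).
  { pose proof (final_count_cases m (c k) Hm); lia. }
  apply H1.
  - repeat constructor; simpl; tauto.
  - intros x [<- | []]; rewrite in_labels; auto.
Qed.

Lemma ahead_of_fronts_end m v c k :
  ahead_of_fronts m v c -> (forall i, v i = 0) -> 1 <= k <= m -> k <= c k.
Proof.
  intros Hf Hv Hk; destruct (Hf k Hk) as [j [Hj [_ Hj2]]].
  rewrite Hv in Hj2; lia.
Qed.

Theorem theorem2p10 (m : Z) (hm : 1 <= m) (c : config) :
  reachable m init_config c -> terminal m c ->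
  forall k, is_label m k -> c k = k.
Proof.
  intros Hc Hterm k Hk.
  destruct (reachable_invariant m c hm Hc) as (v & Hp & Hright & Hleft).
  pose proof (terminal_profile m v c hm Hp Hterm) as Hv.
  assert (Hsite : forall x, is_label m x -> Z.abs (c x) <= m).
  { intros x; now apply (terminal_sites m v). }
  assert (Hlab : forall x, 1 <= x <= m -> is_label m x /\ is_label m (- x)).
  { unfold is_label; lia. }
  destruct (Z_lt_le_dec 0 k) as [Hk0 | Hk0].
  - apply (distinct_sites_sorted m); [| | destruct Hk; lia].
    + intros x Hx; pose proof (ahead_of_fronts_end m v c x Hright Hv Hx).
      pose proof (Hsite x (proj1 (Hlab x Hx))); lia.
    + intros x y Hx Hy Hxy; apply Hterm; auto; now apply Hlab.
  (* For negative labels the same argument runs in the mirrored configuration. *)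
  - enough (H : mirror c (- k) = - k).
    { unfold mirror in H; rewrite Z.opp_involutive in H; lia. }
    apply (distinct_sites_sorted m); [| | destruct Hk; lia].
    + intros x Hx.
      pose proof (ahead_of_fronts_end m (mirror_profile v) (mirror c) x Hleft) as H.
      pose proof (Hsite (- x) (proj2 (Hlab x Hx))).
      split; [apply H; auto; intros i; apply Hv | unfold mirror; lia].
    + intros x y Hx Hy Hxy; unfold mirror.
      assert (c (- x) <> c (- y)); [| lia].
      apply Hterm; [now apply Hlab | now apply Hlab | lia].
Qed.
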